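(* Let $\{p_n\}_{n\ge 0}$ be a sequence of positive real numbers and let $1<k\le s<\infty$. Let $k^{*}$ be the conjugate index of $k$, i.e. $1/k+1/k^{*}=1$. Then $|\overline{N},p_n|_k\Rightarrow|C,1|_s$ (every series summable $|\overline{N},p_n|_k$ is summable $|C,1|_s$) if and only if both of the following hold: (i) $$\frac{n^{1/k-1/s-1}\,P_n}{p_n}=O(1)\qquad(n\ge 1),$$ and (ii) $$\left(\sum_{v=1}^{m}\left|v+1-\frac{P_v}{p_v}\right|^{k^{*}}\frac1v\right)^{1/k^{*}}=O(m)\qquad(m\ge 1).$$
   Context: For a positive sequence $\{p_n\}_{n\ge0}$ put $P_n=\sum_{i=0}^n p_i$. Given a series $\sum_{n\ge 0} a_n$ with partial sums $s_n=\sum_{i=0}^n a_i$, the $n$th term of its $(\overline{N},p_n)$ (weighted mean) transform is $T_n=\frac1{P_n}\sum_{i=0}^n p_i s_i$. For $k>1$, the series $\sum a_n$ is called summable $|\overline{N},p_n|_k$ if $\sum_{n=1}^\infty n^{k-1}|\Delta T_n|^k<\infty$, where $\Delta T_n=T_n-T_{n-1}$. Summability $|C,1|_s$ (Cesàro of order 1) is the special case of weights all equal to $1$ and exponent $s$, i.e. with $T_n=\frac1{n+1}\sum_{i=0}^n s_i$ and the condition $\sum_{n=1}^\infty n^{s-1}|\Delta T_n|^s<\infty$. The notation $A\Rightarrow B$ between summability methods means that every series summable $A$ is summable $B$. The $O(\cdot)$ bounds are with constants uniform in the indicated free index. *)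

(* Defs.v *)
From HB Require Import structures.
From mathcomp Require Import all_boot all_order all_algebra.
From mathcomp Require Import all_classical all_reals all_analysis.

Set Implicit Arguments.
Unset Strict Implicit.
Unset Printing Implicit Defensive.

Import Order.TTheory GRing.Theory Num.Theory.
Import numFieldNormedType.Exports.

Local Open Scope ring_scope.

Definition partial_sum (R : realType) (a : nat -> R) (n : nat) : R :=
  \sum_(0 <= i < n.+1) a i.

Definition weighted_mean (R : realType) (p a : nat -> R) (n : nat) : R :=
  (partial_sum p n)^-1 * \sum_(0 <= i < n.+1) p i * partial_sum a i.

(** Meant for [1 <= n] only: at [n = 0] truncated [n.-1] makes it [0]. *)
Definition backward_diff (R : realType) (T : nat -> R) (n : nat) : R :=
  T n - T n.-1.

(** A summability method is the predicate on the terms [a] of a series that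
    singles out the summable ones. [abs_Nbar p k] is |Nbar, p_n|_k: the terms
    of the series below are nonnegative, so its sum always exists in [\bar R],
    and summability means that this sum is finite. *)
Definition abs_Nbar (R : realType) (p : nat -> R) (k : R) (a : nat -> R)
    : Prop :=
  (\sum_(1 <= n <oo)
     (n%:R `^ (k - 1)
      * `|backward_diff (weighted_mean p a) n| `^ k)%:E < +oo)%E.

(** |C, 1|_s: all the weights are 1, so that [partial_sum] of them at [n] is
    [n + 1]. *)
Definition abs_C1 (R : realType) (s : R) : (nat -> R) -> Prop :=
  abs_Nbar (fun=> 1) s.

Definition method_implies (R : realType) (A B : (nat -> R) -> Prop) : Prop :=
  forall a : nat -> R, A a -> B a.

(** [f n = O(g n)] for [n >= 1], the constant being uniform over all [n >= 1]
    (not just for [n] large enough). *)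
Definition bigO_ge1 (R : realType) (f g : nat -> R) : Prop :=
  exists C : R, forall n : nat, (1 <= n)%N -> `|f n| <= C * `|g n|.

(* Main.v *)
Require Import Defs.
From HB Require Import structures.
From mathcomp Require Import all_boot all_order all_algebra.
From mathcomp Require Import all_classical all_reals all_analysis.
From mathcomp Require Import ring lra.

(** Let [X n] and [D n] be the differences of the weighted and of the Cesaro
    means of a series, [c n = P_n / p_n], and let [q] be the conjugate index
    of [k]. Both kinds of means determine the partial sums of the series, and
    comparing them gives, for [n >= 1],

      [(n + 1) D n = c n X n + (1 / n) sum_(v < n) (v + 1 - c v) X v]

    ([cesaro_decomposition]). By [mean_diff_surj] the sequence [X] is
    arbitrary for [n >= 1], so the theorem asks when this matrix maps one
    weighted l^k space to a weighted l^s space. It is the sum of a diagonal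
    matrix, whose boundedness from l^k to l^s is the first condition, and of a
    factorable one, whose boundedness is the second.

    Sufficiency. The diagonal part is [ratio_bounded_sums]. The factorable
    part is a Hardy inequality, [factorable_bounded_sums]: Hoelder's
    inequality bounds the sums over [v < n] by [O(n)], which reduces the
    exponent [s] to [k]; a second use of Hoelder's inequality, with other
    weights, and summation by parts then reduce the claim to the elementary
    inequality [hardy_bounded_sums].

    Necessity. The two parts must be separated, and a bound that may depend on
    the series must be made uniform. The recurrence [cesaro_recurrence], which
    involves only two consecutive indices, isolates the diagonal when the
    signs of [X] alternate, and this yields the first condition. The diagonal
    part is then harmless, and for [X] with the signs of [v + 1 - c v] the
    other part has monotone sums. In both cases the information obtained is
    that certain positive functionals are bounded at each nonnegative vector
    of l^k, and a uniform boundedness principle for positive functionals,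
    [dual_bounded], bounds their norms in l^q. These norms are the quantities
    in the two conditions, divided by [m] in the second one. *)

Set Implicit Arguments.
Unset Strict Implicit.
Unset Printing Implicit Defensive.

Import Order.TTheory GRing.Theory Num.Theory.
Import numFieldNormedType.Exports.

Local Open Scope ring_scope.

(** * Series with nonnegative terms *)

(** For nonnegative terms this is convergence of the series from index [1] on;
    finite sums in [R] replace the extended real one everywhere below. *)
Definition bounded_sums (R : realType) (f : nat -> R) : Prop :=
  exists M : R, forall N : nat, \sum_(1 <= n < N.+1) f n <= M.

Lemma nneseries_bounded_sums (R : realType) (f : nat -> R) :
  (forall n, 0 <= f n) ->
  (\sum_(1 <= n <oo) (f n)%:E < +oo)%E <-> bounded_sums f.
Proof.
move=> f0; split=> [flty|[M fM]].
- have S0 : (0 <= \sum_(1 <= n <oo) (f n)%:E)%E.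
    by apply: nneseries_ge0 => n _ _; rewrite lee_fin.
  exists (fine (\sum_(1 <= n <oo) (f n)%:E)%E) => N.
  rewrite -lee_fin fineK ?ge0_fin_numE// -sumEFin.
  by apply: nneseries_lim_ge => n _ _; rewrite lee_fin.
- have {}fM N : \sum_(1 <= n < N) f n <= M.
    by case: N => [|N //]; have := fM 0%N; rewrite !big_geq.
  apply: (@le_lt_trans _ _ M%:E); last exact: ltry.
  apply: lime_le; first by apply: is_cvg_nneseries => n _ _; rewrite lee_fin.
  by near=> N; rewrite sumEFin lee_fin.
  Unshelve. all: by end_near.
Qed.

Lemma bounded_sums_le (R : realType) (C : R) (f g : nat -> R) : 0 <= C ->
  (forall n, (1 <= n)%N -> f n <= C * g n) -> bounded_sums g -> bounded_sums f.
Proof.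
move=> C0 fg [M gM]; exists (C * M) => N.
apply: (@le_trans _ _ (\sum_(1 <= n < N.+1) C * g n)).
  by apply: ler_sum_nat => n /andP[n1 _]; exact: fg.
by rewrite -big_distrr/= ler_wpM2l.
Qed.

Lemma bounded_sumsD (R : realType) (f g : nat -> R) :
  bounded_sums f -> bounded_sums g -> bounded_sums (fun n => f n + g n).
Proof.
by move=> [M fM] [L gL]; exists (M + L) => N; rewrite big_split lerD.
Qed.

Lemma bounded_sums_term (R : realType) (f : nat -> R) :
  (forall n, 0 <= f n) -> bounded_sums f ->
  exists2 M, 0 <= M & forall n, (1 <= n)%N -> f n <= M.
Proof.
move=> f0 [M fM]; exists M => [|[//|n] _].
  by have := fM 0%N; rewrite big_geq.
by apply: le_trans (fM n.+1); rewrite big_nat_recr//= lerDr sumr_ge0.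
Qed.

(** The inclusion of l^1 in l^r: the terms are bounded, so [r - 1] of the [r]
    factors can be pulled out. *)
Lemma bounded_sums_powR (R : realType) (r : R) (g : nat -> R) : 1 <= r ->
  (forall n, 0 <= g n) -> bounded_sums g -> bounded_sums (fun n => g n `^ r).
Proof.
move=> r1 g0 gs; have [M M0 gM] := bounded_sums_term g0 gs.
apply: (bounded_sums_le (C := M `^ (r - 1))) gs; first exact: powR_ge0.
move=> n n1; rewrite -(mulr_powRB1 (g0 n)); last by lra.
rewrite mulrC ler_wpM2r//; apply: ge0_ler_powR; rewrite ?nnegrE ?subr_ge0//.
exact: gM.
Qed.

(** * Inequalities for powers and finite sums *)

Lemma powR_subS_le (R : realType) (q x : R) : 1 < q -> 0 < x ->
  x `^ (1 - q) - (x + 1) `^ (1 - q) <= (q - 1) * x `^ (- q).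
Proof.
move=> q1 x0; have x10 : 0 < 1 + x^-1 by rewrite addr_gt0 ?invr_gt0.
(* Bernoulli's inequality for the negative exponent [1 - q]. *)
have bern : 1 + (1 - q) * x^-1 <= (1 + x^-1) `^ (1 - q).
  rewrite /powR gt_eqF//; apply: le_trans (expR_ge1Dx _).
  rewrite lerD2l ler_nM2l; last by rewrite subr_lt0.
  by apply: le_ln1Dx; apply: (@lt_trans _ _ 0); rewrite ?invr_gt0 ?ltrN10.
have -> : x + 1 = x * (1 + x^-1) by rewrite mulrDr mulr1 divff ?gt_eqF.
have -> : x `^ (- q) = x `^ (1 - q) * x^-1.
  rewrite -[x^-1]powR_inv1 ?ltW// -powRD; last by rewrite (gt_eqF x0) implybT.
  by congr (_ `^ _); ring.
rewrite (powRM _ (ltW x0) (ltW x10)).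
have := ler_wpM2l (powR_ge0 x (1 - q)) bern.
by clear; lra.
Qed.

Lemma le_powR_inv (R : realType) (r x y : R) : 0 < r -> 0 <= x ->
  x `^ r <= y -> x <= y `^ r^-1.
Proof.
move=> r0 x0 xy; have -> : x = (x `^ r) `^ r^-1.
  by rewrite -powRrM divff ?gt_eqF// powRr1.
apply: ge0_ler_powR; rewrite ?nnegrE ?invr_ge0 ?powR_ge0 ?(ltW r0)//.
by apply: le_trans xy; exact: powR_ge0.
Qed.

Lemma powR_add_le (R : realType) (r x y : R) : 0 <= r -> 0 <= x -> 0 <= y ->
  (x + y) `^ r <= 2 `^ r * (x `^ r + y `^ r).
Proof.
move=> r0 x0 y0; wlog xy : x y x0 y0 / x <= y.
  move=> H; case/orP: (le_total x y) => ?; first exact: H.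
  by rewrite addrC [X in _ * X]addrC; exact: H.
apply: (@le_trans _ _ ((2 * y) `^ r)).
  by apply: ge0_ler_powR; rewrite ?nnegrE//; lra.
by rewrite powRM// ler_wpM2l ?powR_ge0// lerDr powR_ge0.
Qed.

(** Induction on [N]: the new term joins the two norms by the inequality for
    two summands. *)
Lemma hoelder_sum (R : realType) (k q : R) (u w : nat -> R) (N : nat) :
  0 < k -> 0 < q -> k^-1 + q^-1 = 1 ->
  (forall v, 0 <= u v) -> (forall v, 0 <= w v) ->
  \sum_(1 <= v < N.+1) u v * w v <=
  (\sum_(1 <= v < N.+1) u v `^ q) `^ q^-1 *
  (\sum_(1 <= v < N.+1) w v `^ k) `^ k^-1.
Proof.
move=> k0 q0 kq u0 w0; elim: N => [|N IH].
  by rewrite !big_geq// mulr_ge0 ?powR_ge0.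
have su : 0 <= \sum_(1 <= v < N.+1) u v `^ q.
  by apply: sumr_ge0 => v _; exact: powR_ge0.
have sw : 0 <= \sum_(1 <= v < N.+1) w v `^ k.
  by apply: sumr_ge0 => v _; exact: powR_ge0.
rewrite !(big_nat_recr N.+1)//=; apply: (le_trans (lerD IH (lexx _))).
have cancelP (x r : R) : 0 < r -> 0 <= x -> (x `^ r^-1) `^ r = x.
  by move=> r0 x0; rewrite -powRrM mulVf ?gt_eqF// powRr1.
rewrite -{2}(cancelP _ _ q0 su) -{2}(cancelP _ _ k0 sw).
by apply: hoelder2; rewrite ?powR_ge0// addrC.
Qed.

(** Summation by parts, in the form of an induction: partial sums of order
    [m ^ q] become of order [m] once the terms are damped by [v ^ (1 - q)]. *)
Lemma abel_powR_le (R : realType) (q C : R) (e : nat -> R) : 1 < q ->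
  (forall v, 0 <= e v) ->
  (forall m, (1 <= m)%N -> \sum_(1 <= v < m.+1) e v <= C * m%:R `^ q) ->
  forall m, \sum_(1 <= v < m.+1) e v * v%:R `^ (1 - q) <= C * q * m%:R.
Proof.
move=> q1 e0 eC.
have C0 : 0 <= C.
  have := eC 1%N isT; rewrite powR1 mulr1; apply: le_trans.
  exact: sumr_ge0.
pose F m := \sum_(1 <= v < m.+1) e v.
(* The induction only pays [C (q - 1)] per step because each drop of the
   decreasing weight [m ^ (1 - q)] is weighed against [F m <= C m ^ q]. *)
suff H m : \sum_(1 <= v < m.+1) e v * v%:R `^ (1 - q) <=
    F m * m%:R `^ (1 - q) + C * (q - 1) * m%:R.
  case=> [|m]; first by rewrite big_geq// mulr0.
  have m0 : (0 : R) < m.+1%:R by rewrite ltr0n.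
  apply: (le_trans (H _)).
  suff : F m.+1 * m.+1%:R `^ (1 - q) <= C * m.+1%:R by clear; lra.
  apply: (@le_trans _ _ (C * m.+1%:R `^ q * m.+1%:R `^ (1 - q))).
    by rewrite ler_wpM2r ?powR_ge0// eC.
  rewrite -mulrA -powRD ?(gt_eqF m0) ?implybT//.
  by rewrite (addrC q) subrK powRr1 ?(ltW m0).
elim: m => [|m IH].
  by rewrite /F !big_geq// mul0r mulr0 addr0.
have FS : F m.+1 = F m + e m.+1 by rewrite /F big_nat_recr.
rewrite big_nat_recr//= FS.
suff : F m * (m%:R `^ (1 - q) - (m%:R + 1) `^ (1 - q)) <= C * (q - 1).
  by move: IH; rewrite -natr1; clear; lra.
have [->|m1] := posnP m.
  by rewrite /F big_geq// mul0r mulr_ge0// subr_ge0 ltW.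
have m0 : (0 : R) < m%:R by rewrite ltr0n.
apply: (@le_trans _ _ (F m * ((q - 1) * m%:R `^ (- q)))).
  by rewrite ler_wpM2l ?sumr_ge0// powR_subS_le.
rewrite powRN mulrA ler_pdivrMr ?powR_gt0// mulrAC ler_wpM2r ?eC//.
by rewrite subr_ge0 ltW.
Qed.

(** Exchanging the sums, [v g v] gets multiplied by the tail of the series of
    [1 / n ^ 2] beyond [v], which is about [1 / v]. *)
Lemma hardy_bounded_sums (R : realType) (g : nat -> R) :
  (forall v, 0 <= g v) -> bounded_sums g ->
  bounded_sums (fun n => (\sum_(1 <= v < n) v%:R * g v) / n%:R ^+ 2).
Proof.
move=> g0 [M gM]; exists M => N.
pose G n := \sum_(1 <= v < n) v%:R * g v.
have G0 n : 0 <= G n by apply: sumr_ge0 => v _; rewrite mulr_ge0.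
(* The subtracted boundary term is what makes the induction go through:
   [1 / (N + 1) ^ 2 + 1 / (N + 1) <= 1 / N]. *)
suff H : \sum_(1 <= n < N.+1) G n / n%:R ^+ 2 <=
    \sum_(1 <= v < N) g v - G N / N%:R.
  apply: (le_trans H); rewrite lerBlDr ler_wpDr ?divr_ge0//.
  by case: N {H} => [|N]; [have := gM 0%N; rewrite !big_geq|exact: gM].
elim: N => [|[|N] IH].
- by rewrite /G !big_geq// mul0r subrr.
- by rewrite big_nat1 /G !big_geq// !mul0r subrr.
rewrite big_nat_recr//= [X in _ <= X - _]big_nat_recr//=.
have GS : G N.+2 = G N.+1 + N.+1%:R * g N.+1 by rewrite /G big_nat_recr.
have gE : g N.+1 + G N.+1 / N.+1%:R = G N.+2 / N.+1%:R.
  by rewrite GS mulrDl [_%:R * _]mulrC mulfK ?pnatr_eq0// addrC.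
have x0 : (0 : R) < N.+1%:R by rewrite ltr0n.
suff : G N.+2 / N.+2%:R ^+ 2 + G N.+2 / N.+2%:R <= G N.+2 / N.+1%:R.
  move: IH gE.
  move: (G N.+2 / _) (G N.+2 / _) (G N.+2 / _) (G N.+1 / _) => a b c d.
  by clear; lra.
rewrite -mulrDr ler_wpM2l// -natr1.
move: x0; set x := N.+1%:R => x0.
rewrite -subr_ge0.
have -> : x^-1 - (((x + 1) ^+ 2)^-1 + (x + 1)^-1) = (x * (x + 1) ^+ 2)^-1.
  by field; rewrite !gt_eqF// addr_gt0.
by rewrite invr_ge0 mulr_ge0 ?exprn_ge0 ?addr_ge0 ?ltW.
Qed.

(** Minkowski's inequality up to a constant, in the weighted form shared by
    all the sequences to be compared. *)
Lemma bounded_sums_triangle (R : realType) (s A : R) (f g h : nat -> R) :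
  0 <= s -> 0 <= A -> (forall n, 0 <= f n) -> (forall n, 0 <= g n) ->
  (forall n, 0 <= h n) -> (forall n, (1 <= n)%N -> f n <= A * g n + h n) ->
  bounded_sums (fun n => g n `^ s / n%:R) ->
  bounded_sums (fun n => h n `^ s / n%:R) ->
  bounded_sums (fun n => f n `^ s / n%:R).
Proof.
move=> s0 A0 f0 g0 h0 fgh gs hs.
have Ags : bounded_sums (fun n => (A * g n) `^ s / n%:R).
  apply: (bounded_sums_le (C := A `^ s)) gs => [|n _]; first exact: powR_ge0.
  by rewrite powRM// mulrA.
apply: (bounded_sums_le (C := 2 `^ s)) (bounded_sumsD Ags hs).
  exact: powR_ge0.
move=> n n1; rewrite -mulrDl mulrA ler_wpM2r ?invr_ge0//.
apply: le_trans (powR_add_le s0 (mulr_ge0 A0 (g0 n)) (h0 n)).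
by apply: ge0_ler_powR; rewrite ?nnegrE ?addr_ge0 ?mulr_ge0 ?fgh.
Qed.

(** Nondecreasing partial sums cannot be much larger at [m] than on average
    over the following block of [m] indices. *)
Lemma sums_linear_growth (R : realType) (s : R) (t : nat -> R) : 0 < s ->
  (forall v, 0 <= t v) ->
  bounded_sums (fun n => ((\sum_(1 <= v < n) t v) / n%:R) `^ s / n%:R) ->
  exists C, forall m, (1 <= m)%N -> \sum_(1 <= v < m.+1) t v <= C * m%:R.
Proof.
move=> s0 t0 [M SM].
pose S n := \sum_(1 <= v < n) t v.
have S0 n : 0 <= S n by exact: sumr_ge0.
have M0 : 0 <= M by have := SM 0%N; rewrite big_geq.
have Sle m n : (1 <= m)%N -> (m <= n)%N -> S m <= S n.
  by move=> m1 mn; rewrite /S [leRHS](big_cat_nat (n := m))//= lerDl sumr_ge0.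
exists (2 * (2 * M) `^ s^-1) => m m1; rewrite -/(S m.+1).
have m0 : (0 : R) < m%:R by rewrite ltr0n.
pose b : R := 2 * m%:R.
have b0 : 0 < b by rewrite mulr_gt0.
have Sb0 : 0 <= S m.+1 / b by rewrite divr_ge0// ltW.
(* Each of the [m] terms of index [m < n <= 2 m] is at least the left-hand side
   divided by [b]. *)
have blk : (S m.+1 / b) `^ s <= 2 * M.
  have := SM (m + m)%N; rewrite (big_cat_nat (n := m.+1))//=; last first.
    by rewrite ltnS leq_addr.
  have h : (S m.+1 / b) `^ s / b *+ m <=
      \sum_(m.+1 <= n < (m + m).+1) (S n / n%:R) `^ s / n%:R.
    rewrite (_ : _ *+ m = \sum_(m.+1 <= n < (m + m).+1) (S m.+1 / b) `^ s / b).
      apply: ler_sum_nat => n /andP[mn nm].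
      have n0 : (0 : R) < n%:R by rewrite ltr0n; exact: leq_trans mn.
      have nb : n%:R <= b.
        by rewrite /b -natrM ler_nat mul2n -addnn -ltnS.
      have ib : b^-1 <= n%:R^-1 by rewrite lef_pV2.
      apply: ler_pM; rewrite ?powR_ge0 ?invr_ge0 ?(ltW b0)//.
      apply: ge0_ler_powR; rewrite ?nnegrE ?(ltW s0)// ?divr_ge0 ?(ltW n0)//.
      by apply: ler_pM; rewrite ?invr_ge0 ?(ltW b0)// Sle.
    by rewrite sumr_const_nat subSS addnK.
  have h0 : 0 <= \sum_(1 <= n < m.+1) (S n / n%:R) `^ s / n%:R.
    by apply: sumr_ge0 => n _; rewrite divr_ge0 ?powR_ge0.
  have e : (S m.+1 / b) `^ s / b *+ m = (S m.+1 / b) `^ s / 2.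
    by rewrite -mulr_natr /b; field; rewrite gt_eqF.
  by move: h h0; rewrite e -/S; move: (_ `^ s) => u; clear; lra.
rewrite mulrAC -ler_pdivrMl// -/b mulrC.
exact: le_powR_inv.
Qed.

(** * A uniform boundedness principle for positive functionals *)

(** A gliding hump without choices of signs: the weighted sum of the rows
    dominates a fixed multiple of each of them, and its own sum is finite
    because the order of summation is irrelevant for nonnegative terms. *)
Lemma bounded_sums_majorant (R : realType) (Z : nat -> nat -> R) :
  (forall j v, 0 <= Z j v) ->
  (forall j N, \sum_(1 <= v < N.+1) Z j v <= 1) ->
  exists z : nat -> R, [/\ forall v, 0 <= z v, bounded_sums z &
    forall j v, (1 <= v)%N -> Z j v / (2 ^ j.+1)%:R <= z v].
Proof.
move=> Z0 Z1.
pose e (j : nat) : R := ((2 ^ j.+1)%:R)^-1.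
have e0 j : 0 <= e j by rewrite invr_ge0.
have eZ0 j v : (0 <= (e j * Z j v)%:E)%E by rewrite lee_fin mulr_ge0.
have e1 : (\sum_(0 <= j <oo) (e j)%:E <= 1)%E.
  have := @epsilon_trick0 R 1 xpredT ler01.
  by rewrite (eq_eseriesr (g := fun j => (e j)%:E))// => j _; rewrite div1r.
pose E v : \bar R := (\sum_(0 <= j <oo) (e j * Z j v)%:E)%E.
have E0 v : (0 <= E v)%E by apply: nneseries_ge0 => j _ _; exact: eZ0.
have Es N : (\sum_(1 <= v < N.+1) E v <= 1)%E.
  rewrite /E -nneseries_sum_nat//; apply: le_trans e1.
  apply: lee_nneseries => [j _ _|j _]; first exact: sume_ge0.
  by rewrite sumEFin lee_fin -big_distrr/= -[leRHS]mulr1 ler_wpM2l.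
have Ef v : (1 <= v)%N -> E v \is a fin_num.
  move=> v1; rewrite ge0_fin_numE//; apply: (@le_lt_trans _ _ 1%E); last first.
    exact: ltry.
  case: v v1 => // v _; apply: le_trans (Es v.+1).
  by rewrite big_nat_recr//= leeDr// sume_ge0.
exists (fun v => fine (E v)); split=> [v||j v v1].
- exact: fine_ge0.
- exists 1 => N; rewrite -lee_fin -sumEFin; apply: le_trans (Es N).
  rewrite big_nat_cond [leRHS]big_nat_cond.
  by apply: lee_sum => v; rewrite andbT => /andP[v1 _]; rewrite fineK// Ef.
- rewrite -lee_fin fineK ?Ef// mulrC.
  apply: le_trans (nneseries_lim_ge j.+1 (P := xpredT) _); last first.
    by move=> *; exact: eZ0.
  by rewrite big_nat_recr//= leeDr// sume_ge0.
Qed.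

Lemma sum_truncated_le (R : realType) (f : nat -> R) (m N : nat) :
  (forall v, 0 <= f v) ->
  \sum_(1 <= v < N.+1) (if (v <= m)%N then f v else 0) <=
  \sum_(1 <= v < m.+1) f v.
Proof.
move=> f0; rewrite -big_mkcond/=; have [mN|Nm] := leqP m N.
  by rewrite [leRHS](big_nat_widen _ _ N.+1).
rewrite [leRHS](big_cat_nat (n := N.+1))//=; last by rewrite ltnW.
rewrite ler_wpDr ?sumr_ge0// big_mkcond/=.
by apply: ler_sum => v _; case: ifP.
Qed.

(** The uniform boundedness principle on l^k, for positive functionals given
    by finite rows. If the dual norms of the rows [w m] were unbounded, take
    a sequence of rows whose norms grow fast enough and a nonnegative [x] in
    l^k that dominates a norming vector of the j-th of them, scaled by
    [(1 / 2 ^ (j + 1)) ^ (1 / k)]: the rows are unbounded at [x]. *)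
Lemma dual_bounded (R : realType) (k q : R) (w : nat -> nat -> R) :
  1 < k -> 0 < q -> k^-1 + q^-1 = 1 -> (forall m v, 0 <= w m v) ->
  (forall x : nat -> R, (forall v, 0 <= x v) ->
     bounded_sums (fun v => x v `^ k) ->
     exists C, forall m, (1 <= m)%N -> \sum_(1 <= v < m.+1) w m v * x v <= C) ->
  exists C, forall m, (1 <= m)%N -> \sum_(1 <= v < m.+1) w m v `^ q <= C.
Proof.
move=> k1 q0 kq w0 H; apply: contrapT => /forallNP nC.
have k0 : 0 < k by lra.
have qk : q / k = q - 1.
  by rewrite (_ : k^-1 = 1 - q^-1) ?mulrBr ?mulr1 ?divff ?gt_eqF//; lra.
pose W m := \sum_(1 <= v < m.+1) w m v `^ q.
pose a (j : nat) : R := (2 ^ j.+1)%:R.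
have a1 j : 1 <= a j by rewrite ler1n expn_gt0.
have a0 j : 0 < a j by exact: lt_le_trans (a1 j).
(* The threshold [a j ^ (2 q)] leaves a factor [a j] after the loss of at most
   [a j] caused by the weight [1 / a j] of the j-th row in the majorant. *)
have /choice[mm mmP] : forall j, exists m, (1 <= m)%N /\ (a j * a j) `^ q < W m.
  move=> j; have /existsNP[m /not_implyP[m1 /negP]] := nC ((a j * a j) `^ q).
  by rewrite -ltNge => ?; exists m.
have W0 j : 0 < W (mm j) by apply: le_lt_trans (mmP j).2; exact: powR_ge0.
(* The extremal vectors for Hoelder's inequality, raised to the power [k]. *)
pose Z j v := if (v <= mm j)%N then w (mm j) v `^ q / W (mm j) else 0.
have Z0 j v : 0 <= Z j v.
  by rewrite /Z; case: ifP => // _; rewrite divr_ge0 ?powR_ge0// ltW.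
have Z1 j N : \sum_(1 <= v < N.+1) Z j v <= 1.
  apply: le_trans (sum_truncated_le _ _ _) _.
    by move=> v; rewrite divr_ge0 ?powR_ge0// ltW.
  by rewrite -big_distrl/= -[X in X / _]/(W _) divff ?gt_eqF.
have [z [zge0 zs Zz]] := bounded_sums_majorant Z0 Z1.
have [||C HC] := H (fun v => z v `^ k^-1).
- by move=> v; exact: powR_ge0.
- rewrite (_ : (fun v => _) = z)//; apply/funext => v.
  by rewrite -powRrM mulVf ?gt_eqF// powRr1.
have lb j : a j <= C.
  have [m1 Wgt] := mmP j; apply: le_trans (HC _ m1).
  set m := mm j in m1 Wgt *.
  pose b := W m * a j.
  have Wm0 : 0 < W m := W0 j.
  have b0 : 0 < b by rewrite mulr_gt0.
  apply: (@le_trans _ _ (W m * (b `^ k^-1)^-1)).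
    have -> : b `^ k^-1 = W m `^ k^-1 * a j `^ k^-1 by rewrite powRM ?ltW.
    rewrite invfM mulrA -powRN -{1}(powRr1 (ltW Wm0)) -powRD; last first.
      by rewrite (gt_eqF Wm0) implybT.
    rewrite (_ : 1 - k^-1 = q^-1); last by lra.
    rewrite ler_pdivlMr ?powR_gt0//.
    apply: (@le_trans _ _ (a j * a j)).
      rewrite ler_wpM2l ?(ltW (a0 j))//; apply: ler1_powR => //.
      by rewrite invf_le1// ltW.
    by apply: le_powR_inv => //; [rewrite mulr_ge0 ?(ltW (a0 j))|exact: ltW].
  rewrite big_distrl/=; apply: ler_sum_nat => v /andP[v1 vm].
  rewrite -(mulr_powRB1 (w0 m v) q0) -mulrA ler_wpM2l//.
  apply: (@le_trans _ _ ((w m v `^ q / b) `^ k^-1)); last first.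
    apply: ge0_ler_powR; rewrite ?nnegrE ?invr_ge0 ?divr_ge0 ?powR_ge0//.
    - exact: ltW.
    - exact: ltW.
    by apply: le_trans (Zz j v v1); rewrite /Z -/m -ltnS vm invfM mulrA.
  rewrite powRM ?powR_ge0 ?invr_ge0 ?(ltW b0)// -powRrM qk.
  by rewrite -(powR_inv1 (ltW b0)) powRAC powR_inv1 ?powR_ge0.
have := lb (Num.truncn C).
apply/negP; rewrite -ltNge.
have C0 : 0 <= C by apply: le_trans (lb 0%N); exact: ltW.
apply: (lt_trans (truncnS_gt C)); rewrite ltr_nat; exact: ltn_expl.
Qed.

(** * Cesaro means of a series in terms of its weighted means *)

Definition weight_ratio (R : realType) (p : nat -> R) (n : nat) : R :=
  partial_sum p n / p n.

(** [v + 1] is the ratio for constant weights, so the coefficients measure how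
    far [p] is from the weights of the Cesaro means. *)
Definition defect_sum (R : realType) (p X : nat -> R) (n : nat) : R :=
  \sum_(1 <= v < n) (v%:R + 1 - weight_ratio p v) * X v.

Lemma partial_sumS (R : realType) (a : nat -> R) (n : nat) :
  partial_sum a n.+1 = partial_sum a n + a n.+1.
Proof. by rewrite /partial_sum big_nat_recr. Qed.

Lemma partial_sum0 (R : realType) (a : nat -> R) : partial_sum a 0 = a 0%N.
Proof. by rewrite /partial_sum big_nat1. Qed.

Lemma partial_sum_gt0 (R : realType) (p : nat -> R) (n : nat) :
  (forall i, 0 < p i) -> 0 < partial_sum p n.
Proof.
move=> p0; elim: n => [|n IH]; first by rewrite partial_sum0.
by rewrite partial_sumS addr_gt0.
Qed.

Lemma weight_ratio_ge1 (R : realType) (p : nat -> R) (n : nat) :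
  (forall i, 0 < p i) -> 1 <= weight_ratio p n.
Proof.
move=> p0; rewrite /weight_ratio ler_pdivlMr// mul1r.
case: n => [|n]; first by rewrite partial_sum0.
by rewrite partial_sumS lerDr ltW// partial_sum_gt0.
Qed.

Lemma weight_ratio1 (R : realType) (n : nat) :
  weight_ratio (fun=> 1 : R) n = n%:R + 1.
Proof.
by rewrite /weight_ratio divr1 /partial_sum sumr_const_nat subn0 -natr1.
Qed.

(** The inversion formula that recovers a series from its weighted means; the
    correction is zero at [n = 0]. *)
Lemma partial_sum_weighted_mean (R : realType) (p a : nat -> R) (n : nat) :
  (forall i, 0 < p i) ->
  partial_sum a n = weighted_mean p a n +
    (weight_ratio p n - 1) * backward_diff (weighted_mean p a) n.
Proof.
move=> p0; rewrite /backward_diff /weight_ratio; case: n => [|n] /=.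
  rewrite subrr mulr0 addr0 /weighted_mean !big_nat1 !partial_sum0.
  by rewrite mulKf// gt_eqF.
rewrite /weighted_mean [X in _^-1 * X]big_nat_recr//=.
have Pn := partial_sum_gt0 n p0; rewrite !partial_sumS.
have p1 := p0 n.+1; field.
by rewrite !gt_eqF// addr_gt0.
Qed.

(** The inversion formula, for [p] and for constant weights, gives two
    expressions of the same partial sum; this is the difference of the
    resulting equations at [n.+1] and at [n]. It is local: no sum over earlier
    indices is left, which makes the diagonal condition accessible. *)
Lemma cesaro_recurrence (R : realType) (p a : nat -> R) (n : nat) :
  (forall i, 0 < p i) ->
  let X := backward_diff (weighted_mean p a) in
  let D := backward_diff (weighted_mean (fun=> 1) a) in
  (n%:R + 2) * D n.+1 =
  n%:R * D n + weight_ratio p n.+1 * X n.+1 - (weight_ratio p n - 1) * X n.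
Proof.
move=> p0 X D.
have q0 (i : nat) : 0 < (1 : R) by [].
have e0 := partial_sum_weighted_mean a n p0.
have := partial_sum_weighted_mean (p := fun=> 1) a n q0; rewrite e0 {e0}.
have e1 := partial_sum_weighted_mean a n.+1 p0.
have := partial_sum_weighted_mean (p := fun=> 1) a n.+1 q0; rewrite e1 {e1}.
rewrite !weight_ratio1 -/X -/D.
have -> : weighted_mean p a n.+1 = weighted_mean p a n + X n.+1.
  by rewrite /X /backward_diff /= addrC subrK.
have -> : weighted_mean (fun=> 1) a n.+1 = weighted_mean (fun=> 1) a n + D n.+1.
  by rewrite /D /backward_diff /= addrC subrK.
rewrite -natr1; clear; lra.
Qed.

(** Splits the matrix that takes the differences of the weighted means to
    those of the Cesaro means into a diagonal part and a factorable part. *)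
Lemma cesaro_decomposition (R : realType) (p a : nat -> R) (n : nat) :
  (forall i, 0 < p i) -> (1 <= n)%N ->
  let X := backward_diff (weighted_mean p a) in
  let D := backward_diff (weighted_mean (fun=> 1) a) in
  (n%:R + 1) * D n = weight_ratio p n * X n + defect_sum p X n / n%:R.
Proof.
move=> p0; case: n => // n _ X D.
have e m : (m%:R + 2) * D m.+1 =
    m%:R * D m + weight_ratio p m.+1 * X m.+1 - (weight_ratio p m - 1) * X m.
  exact: cesaro_recurrence.
have n0 : n.+1%:R != 0 :> R by rewrite pnatr_eq0.
(* Cleared of denominators, the recurrence telescopes. *)
suff H : (n%:R + 1) * (n%:R + 2) * D n.+1 =
    (n%:R + 1) * weight_ratio p n.+1 * X n.+1 + defect_sum p X n.+1.
  apply: (mulfI n0); rewrite [RHS]mulrDr [X in _ = _ + X]mulrC mulfVK//.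
  by move: H; rewrite -natr1; clear; lra.
elim: n {n0} => [|n IH].
  rewrite -mulrA e /defect_sum big_geq// [weight_ratio p 0]/weight_ratio.
  rewrite partial_sum0 divff ?gt_eqF//; ring.
rewrite -mulrA e /defect_sum big_nat_recr//= -/(defect_sum p X n.+1) -natr1.
by move: IH; clear; lra.
Qed.

(** Lets necessity be tested on arbitrary sequences. The value at [0] is
    forced, since [backward_diff] vanishes there. *)
Lemma mean_diff_surj (R : realType) (p X : nat -> R) :
  (forall i, 0 < p i) -> X 0%N = 0 ->
  exists a, backward_diff (weighted_mean p a) = X.
Proof.
move=> p0 X0.
pose T n := \sum_(1 <= v < n.+1) X v.
pose s n := T n + (weight_ratio p n - 1) * X n.
pose a n := if n is m.+1 then s m.+1 - s m else s 0%N.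
have sE n : partial_sum a n = s n.
  elim: n => [|n IH]; first by rewrite partial_sum0.
  by rewrite partial_sumS IH /= addrC subrK.
have TS n : T n.+1 = T n + X n.+1 by rewrite /T big_nat_recr.
have ps n : \sum_(0 <= i < n.+1) p i * partial_sum a i = partial_sum p n * T n.
  elim: n => [|n IH].
    by rewrite big_nat1 sE /s X0 mulr0 addr0 partial_sum0.
  rewrite big_nat_recr//= IH sE /s TS /weight_ratio partial_sumS.
  by field; rewrite gt_eqF.
have TE : weighted_mean p a = T.
  apply/funext => n.
  by rewrite /weighted_mean ps mulKf// gt_eqF ?partial_sum_gt0.
exists a; rewrite TE; apply/funext => -[|n]; rewrite /backward_diff.
  by rewrite subrr X0.
by rewrite TS /= addrC addKr.
Qed.

(** * Summability in terms of the two parts of the matrix *)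

Lemma abs_NbarE (R : realType) (p a : nat -> R) (k : R) :
  abs_Nbar p k a <-> bounded_sums (fun n =>
    n%:R `^ (k - 1) * `|backward_diff (weighted_mean p a) n| `^ k).
Proof.
by apply: nneseries_bounded_sums => n; rewrite mulr_ge0 ?powR_ge0.
Qed.

Lemma abs_C1E (R : realType) (a : nat -> R) (s : R) : 1 < s ->
  abs_C1 s a <-> bounded_sums (fun n =>
    (n%:R * `|backward_diff (weighted_mean (fun=> 1) a) n|) `^ s / n%:R).
Proof.
move=> s1; rewrite /abs_C1 abs_NbarE.
set f := (X in bounded_sums X <-> _); set g := (X in _ <-> bounded_sums X).
suff -> : f = g by [].
apply/funext => -[|n]; rewrite /f /g.
  by rewrite powR0 ?mul0r ?invr0 ?mulr0// gt_eqF// subr_gt0.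
have n0 : (0 : R) < n.+1%:R by rewrite ltr0n.
rewrite powRM// mulrAC -(@mulr_powRB1 _ n.+1%:R s (ltW n0)); last by lra.
by congr (_ * _); rewrite mulrAC divff ?mul1r// gt_eqF.
Qed.

(** The diagonal part maps l^k to l^k when its normalized entries are bounded,
    and l^k is included in l^s. *)
Lemma ratio_bounded_sums (R : realType) (k s C : R) (c X : nat -> R) :
  1 < k -> k <= s -> (forall n, 0 <= c n) ->
  (forall n, (1 <= n)%N -> n%:R `^ (1 / k - 1 / s - 1) * c n <= C) ->
  bounded_sums (fun n => n%:R `^ (k - 1) * `|X n| `^ k) ->
  bounded_sums (fun n => (c n * `|X n|) `^ s / n%:R).
Proof.
move=> k1 ks c0 cC Xs.
have k0 : 0 < k by lra.
have s0 : 0 < s by lra.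
have C0 : 0 <= C by apply: le_trans (cC 1%N isT); rewrite mulr_ge0 ?powR_ge0.
have g0 n : 0 <= n%:R `^ (k - 1) * `|X n| `^ k by rewrite mulr_ge0 ?powR_ge0.
have sk1 : 1 <= s / k by rewrite ler_pdivlMr// mul1r.
have gs := bounded_sums_powR sk1 g0 Xs.
apply: (bounded_sums_le (C := C `^ s)) gs => [|n n1]; first exact: powR_ge0.
have n0 : (0 : R) < n%:R by rewrite ltr0n.
have -> : (c n * `|X n|) `^ s / n%:R =
    (n%:R `^ (1 / k - 1 / s - 1) * c n) `^ s *
    (n%:R `^ (k - 1) * `|X n| `^ k) `^ (s / k).
  rewrite !powRM ?powR_ge0// -!powRrM (_ : k * (s / k) = s); last first.
    by field; rewrite gt_eqF.
  rewrite mulrACA -powRD ?(gt_eqF n0) ?implybT//.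
  rewrite (_ : _ + _ = -1); last by field; rewrite !gt_eqF.
  by rewrite powR_inv1 ?ltW// mulrC.
rewrite ler_wpM2r ?powR_ge0//; apply: ge0_ler_powR; rewrite ?nnegrE ?(ltW s0)//.
- by rewrite mulr_ge0 ?powR_ge0.
- exact: cC.
Qed.

(** Once the diagonal part is harmless, summability |C, 1|_s only depends on
    the factorable part, in both directions. *)
Lemma abs_C1_defect_sum (R : realType) (p a : nat -> R) (s : R) :
  (forall i, 0 < p i) -> 1 < s ->
  let X := backward_diff (weighted_mean p a) in
  bounded_sums (fun n => (weight_ratio p n * `|X n|) `^ s / n%:R) ->
  abs_C1 s a <->
  bounded_sums (fun n => (`|defect_sum p X n| / n%:R) `^ s / n%:R).
Proof.
move=> p0 s1 X cX; rewrite (abs_C1E _ s1).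
set D := backward_diff (weighted_mean (fun=> 1) a).
have c0 n : 0 <= weight_ratio p n.
  by apply: le_trans (weight_ratio_ge1 n p0).
have s0 : 0 <= s by lra.
have cX0 n : 0 <= weight_ratio p n * `|X n| by rewrite mulr_ge0.
have D0 n : 0 <= n%:R * `|D n| by rewrite mulr_ge0.
have S0 n : 0 <= `|defect_sum p X n| / n%:R by rewrite divr_ge0.
have nDE n : (1 <= n)%N ->
    (n%:R + 1) * D n = weight_ratio p n * X n + defect_sum p X n / n%:R.
  exact: cesaro_decomposition.
split=> H.
- apply: (bounded_sums_triangle (A := 2)) H cX => // n n1.
  have -> : `|defect_sum p X n| / n%:R = `|defect_sum p X n / n%:R|.
    by rewrite normf_div normr_nat.
  have -> : defect_sum p X n / n%:R = (n%:R + 1) * D n - weight_ratio p n * X n.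
    by rewrite nDE// addrC addKr.
  apply: le_trans (ler_normB _ _) _.
  rewrite (normrM _ (D n)) (normrM _ (X n)) (ger0_norm (c0 n)).
  rewrite lerD2r mulrA ler_wpM2r// ger0_norm//.
  by have := n1; rewrite -(ler1n R); clear; lra.
- apply: (bounded_sums_triangle (A := 1)) cX H => // n n1.
  rewrite mul1r.
  have -> : `|defect_sum p X n| / n%:R = `|defect_sum p X n / n%:R|.
    by rewrite normf_div normr_nat.
  rewrite -{1}(ger0_norm (c0 n)) -normrM; apply: le_trans (ler_normD _ _).
  rewrite -nDE// normrM ler_wpM2r// ger0_norm// lerDl//.
Qed.

(** * Sufficiency: the factorable part *)

Lemma norm_sum_mul_le (R : realType) (d X : nat -> R) (n : nat) :
  `|\sum_(1 <= v < n) d v * X v| <= \sum_(1 <= v < n) `|d v| * `|X v|.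
Proof.
apply: le_trans (ler_norm_sum _ _ _) _.
by apply: ler_sum => v _; rewrite normrM.
Qed.

(** Hoelder's inequality with the weights split as
    [(|d v| v ^ (- 1 / q)) (v ^ (1 / q) |X v|)]: crude, but enough to reduce
    the exponent [s] to [k]. *)
Lemma norm_sum_linear_growth (R : realType) (k q C : R) (d X : nat -> R) :
  1 < k -> 1 < q -> k^-1 + q^-1 = 1 ->
  (forall m, (1 <= m)%N ->
     \sum_(1 <= v < m.+1) `|d v| `^ q / v%:R <= C * m%:R `^ q) ->
  bounded_sums (fun n => n%:R `^ (k - 1) * `|X n| `^ k) ->
  exists2 K, 0 <= K &
    forall n, `|\sum_(1 <= v < n) d v * X v| / n%:R <= K.
Proof.
move=> k1 q1 kq dC Xs.
have k0 : 0 < k by lra.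
have q0 : 0 < q by lra.
have kq' : k / q = k - 1.
  by rewrite (_ : q^-1 = 1 - k^-1) ?mulrBr ?mulr1 ?divff ?gt_eqF//; lra.
have C0 : 0 <= C.
  have := dC 1%N isT; rewrite powR1 mulr1; apply: le_trans.
  by apply: sumr_ge0 => v _; rewrite divr_ge0 ?powR_ge0.
pose g n := n%:R `^ (k - 1) * `|X n| `^ k.
have [M gM] := Xs.
have M0 : 0 <= M by have := gM 0%N; rewrite big_geq.
pose K := C `^ q^-1 * M `^ k^-1.
have K0 : 0 <= K by rewrite mulr_ge0 ?powR_ge0.
exists K => //.
case=> [|m]; first by rewrite invr0 mulr0.
have x0 v : (1 <= v)%N -> (0 : R) < v%:R by rewrite ltr0n.
apply: (@le_trans _ _ (K * m%:R / m.+1%:R)); last first.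
  by rewrite -mulrA -[leRHS]mulr1 ler_wpM2l// ler_pdivrMr// mul1r ler_nat.
rewrite ler_wpM2r ?invr_ge0//; apply: le_trans (norm_sum_mul_le _ _ _) _.
have [->|m1] := posnP m; first by rewrite big_geq// mulr0.
pose u v := `|d v| * v%:R `^ (- q^-1); pose w v := v%:R `^ q^-1 * `|X v|.
have -> : \sum_(1 <= v < m.+1) `|d v| * `|X v| =
    \sum_(1 <= v < m.+1) u v * w v.
  apply: eq_big_nat => v /andP[v1 _].
  rewrite /u /w mulrA -[_ * _ * _ `^ _]mulrA.
  by rewrite -powRD ?addNr ?powRr0 ?mulr1// (gt_eqF (x0 _ v1)) implybT.
have u0 v : 0 <= u v by rewrite mulr_ge0 ?powR_ge0.
have w0 v : 0 <= w v by rewrite mulr_ge0 ?powR_ge0.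
apply: le_trans (hoelder_sum m k0 q0 kq u0 w0) _.
have -> : K * m%:R = (C * m%:R `^ q) `^ q^-1 * M `^ k^-1.
  by rewrite powRM ?powR_ge0// -powRrM divff ?gt_eqF// powRr1// mulrAC.
have up v : (1 <= v)%N -> u v `^ q = `|d v| `^ q / v%:R.
  move=> v1; rewrite /u powRM ?powR_ge0// -powRrM mulNr mulVf ?gt_eqF//.
  by rewrite powR_inv1.
have wp v : w v `^ k = g v.
  by rewrite /w /g powRM ?powR_ge0// -powRrM [q^-1 * k]mulrC kq'.
apply: ler_pM; rewrite ?powR_ge0//.
  apply: ge0_ler_powR; rewrite ?nnegrE ?invr_ge0 ?(ltW q0)//.
  - by apply: sumr_ge0 => v _; exact: powR_ge0.
  - by rewrite mulr_ge0 ?powR_ge0.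
  rewrite (eq_big_nat _ _ (F2 := fun v => `|d v| `^ q / v%:R)); first exact: dC.
  by move=> v /andP[v1 _]; exact: up.
apply: ge0_ler_powR; rewrite ?nnegrE ?invr_ge0 ?(ltW k0)//.
  by apply: sumr_ge0 => v _; exact: powR_ge0.
by rewrite (eq_bigr g) => [|v _]; [exact: gM|exact: wp].
Qed.

(** Hoelder's inequality with the weights split as [(|d v| / v) (v |X v|)]
    instead. The q-th powers of the first factors sum to [O(n)] by
    [abel_powR_le], and the second factors carry the extra weight [v] which
    [hardy_bounded_sums] can absorb. *)
Lemma norm_sum_powR_le (R : realType) (k q C : R) (d X : nat -> R) (n : nat) :
  1 < k -> 1 < q -> k^-1 + q^-1 = 1 ->
  (forall m, (1 <= m)%N ->
     \sum_(1 <= v < m.+1) `|d v| `^ q / v%:R <= C * m%:R `^ q) ->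
  (1 <= n)%N ->
  `|\sum_(1 <= v < n) d v * X v| `^ k <= (C * q * n%:R) `^ (k - 1) *
    \sum_(1 <= v < n) v%:R * (v%:R `^ (k - 1) * `|X v| `^ k).
Proof.
move=> k1 q1 kq dC.
have k0 : 0 < k by lra.
have q0 : 0 < q by lra.
have kq' : k / q = k - 1.
  by rewrite (_ : q^-1 = 1 - k^-1) ?mulrBr ?mulr1 ?divff ?gt_eqF//; lra.
have C0 : 0 <= C.
  have := dC 1%N isT; rewrite powR1 mulr1; apply: le_trans.
  by apply: sumr_ge0 => v _; rewrite divr_ge0 ?powR_ge0.
pose g n := n%:R `^ (k - 1) * `|X n| `^ k.
have g0 v : 0 <= g v by rewrite mulr_ge0 ?powR_ge0.
pose y n := `|\sum_(1 <= v < n) d v * X v|.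
rewrite -/(y n).
case: n => // m _; apply: (@le_trans _ _
  ((C * q * m%:R) `^ (k - 1) * \sum_(1 <= v < m.+1) v%:R * g v)); last first.
  rewrite ler_wpM2r//; first by apply: sumr_ge0 => v _; rewrite mulr_ge0.
  apply: ge0_ler_powR;
    rewrite ?nnegrE ?mulr_ge0 ?(ltW q0) ?subr_ge0 ?(ltW k1)//.
  by rewrite ler_wpM2l ?mulr_ge0 ?(ltW q0)// ler_nat.
pose u v := `|d v| / v%:R; pose w v := v%:R * `|X v|.
have u0 v : 0 <= u v by rewrite divr_ge0.
have w0 v : 0 <= w v by rewrite mulr_ge0.
have yh : y m.+1 <= (\sum_(1 <= v < m.+1) u v `^ q) `^ q^-1 *
                  (\sum_(1 <= v < m.+1) w v `^ k) `^ k^-1.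
  apply: le_trans (hoelder_sum m k0 q0 kq u0 w0).
  apply: le_trans (norm_sum_mul_le _ _ _) _.
  rewrite le_eqVlt; apply/orP; left; apply/eqP.
  apply: eq_big_nat => v /andP[v1 _]; rewrite /u /w.
  by rewrite mulrA mulfVK// pnatr_eq0 -lt0n.
have up : \sum_(1 <= v < m.+1) u v `^ q <= C * q * m%:R.
  have := abel_powR_le q1 (e := fun v => `|d v| `^ q / v%:R) _ dC m.
  rewrite (eq_big_nat _ _ (F2 := fun v => u v `^ q)) => [|v /andP[v1 _]].
    by apply=> v; rewrite divr_ge0 ?powR_ge0.
  have v0 : (0 : R) < v%:R by rewrite ltr0n.
  rewrite /u powRM ?invr_ge0// -mulrA -(powR_inv1 (ltW v0)) -powRrM.
  rewrite -powRD; last first.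
    by rewrite (gt_eqF v0) implybT.
  by congr (_ * _ `^ _); ring.
have wp : \sum_(1 <= v < m.+1) w v `^ k = \sum_(1 <= v < m.+1) v%:R * g v.
  apply: eq_big_nat => v _; rewrite /w /g powRM// mulrA mulr_powRB1//.
apply: (@le_trans _ _ (((C * q * m%:R) `^ q^-1 *
    (\sum_(1 <= v < m.+1) v%:R * g v) `^ k^-1) `^ k)).
  apply: ge0_ler_powR; rewrite ?nnegrE ?(ltW k0)// ?mulr_ge0 ?powR_ge0//.
    exact: normr_ge0.
  apply: le_trans yh _; rewrite wp ler_wpM2r ?powR_ge0//.
  apply: ge0_ler_powR; rewrite ?nnegrE ?invr_ge0 ?(ltW q0)//.
  - by apply: sumr_ge0 => v _; exact: powR_ge0.
  - by rewrite !mulr_ge0 ?(ltW q0).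
rewrite powRM ?powR_ge0// -!powRrM mulVf ?gt_eqF// [q^-1 * k]mulrC kq'.
by rewrite powRr1// sumr_ge0// => v _; rewrite mulr_ge0.
Qed.

(** A Hardy inequality with general coefficients [d]. The linear bound on the
    sums takes the exponent from [s] down to [k], where [norm_sum_powR_le] and
    [hardy_bounded_sums] apply. *)
Lemma factorable_bounded_sums (R : realType) (k s q C : R) (d X : nat -> R) :
  1 < k -> k <= s -> 1 < q -> k^-1 + q^-1 = 1 ->
  (forall m, (1 <= m)%N ->
     \sum_(1 <= v < m.+1) `|d v| `^ q / v%:R <= C * m%:R `^ q) ->
  bounded_sums (fun n => n%:R `^ (k - 1) * `|X n| `^ k) ->
  bounded_sums (fun n => (`|\sum_(1 <= v < n) d v * X v| / n%:R) `^ s / n%:R).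
Proof.
move=> k1 ks q1 kq dC Xs.
have k0 : 0 < k by lra.
have q0 : 0 < q by lra.
have C0 : 0 <= C.
  have := dC 1%N isT; rewrite powR1 mulr1; apply: le_trans.
  by apply: sumr_ge0 => v _; rewrite divr_ge0 ?powR_ge0.
pose g n := n%:R `^ (k - 1) * `|X n| `^ k.
have g0 n : 0 <= g n by rewrite mulr_ge0 ?powR_ge0.
pose y n := `|\sum_(1 <= v < n) d v * X v|.
have [K K0 yK] := norm_sum_linear_growth k1 q1 kq dC Xs.
apply: (bounded_sums_le (C := K `^ (s - k) * (C * q) `^ (k - 1)))
  (hardy_bounded_sums g0 Xs); first by rewrite mulr_ge0 ?powR_ge0.
move=> n n1; rewrite -/(y n).
have n0 : (0 : R) < n%:R by rewrite ltr0n.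
have yn0 : 0 <= y n / n%:R by rewrite divr_ge0// normr_ge0.
(* [s - k] of the [s] factors are absorbed by the bound [K]. *)
apply: (@le_trans _ _ (K `^ (s - k) * (y n / n%:R) `^ k / n%:R)).
  rewrite ler_wpM2r ?invr_ge0//.
  rewrite (_ : (y n / n%:R) `^ s = (y n / n%:R) `^ (s - k) * (y n / n%:R) `^ k).
    rewrite ler_wpM2r ?powR_ge0//.
    by apply: ge0_ler_powR; rewrite ?nnegrE ?subr_ge0//; exact: yK.
  by rewrite -powRD ?subrK// gt_eqF//; lra.
rewrite -!mulrA ler_wpM2l ?powR_ge0// (powRM _ (normr_ge0 _)) ?invr_ge0//.
have nk : n%:R^-1 `^ k = (n%:R `^ k)^-1.
  by rewrite -powR_inv1 ?ler0n// powRAC powR_inv1 ?powR_ge0.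
rewrite nk; set S := \sum_(1 <= v < n) v%:R * g v.
have -> : (C * q) `^ (k - 1) * (S / n%:R ^+ 2) =
  (C * q * n%:R) `^ (k - 1) * S / (n%:R `^ k * n%:R).
  rewrite [in RHS]powRM ?mulr_ge0 ?(ltW q0)//.
  rewrite -(mulr_powRB1 (ltW n0) k0); field.
  by rewrite !gt_eqF// powR_gt0.
rewrite -mulrA -invfM ler_wpM2r ?invr_ge0 ?mulr_ge0 ?powR_ge0//.
exact: norm_sum_powR_le.
Qed.

(** * Necessity: test series *)

(** The factor [v ^ (- 1 / q)] turns the weight [v ^ (k - 1)] of the
    summability condition into [1]; the signs [sg] are to be adapted to the
    part of the matrix under study. *)
Lemma test_series (R : realType) (p x sg : nat -> R) (k q : R) :
  (forall i, 0 < p i) -> 1 < k -> 0 < q -> k^-1 + q^-1 = 1 ->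
  (forall v, 0 <= x v) -> (forall v, `|sg v| <= 1) ->
  bounded_sums (fun v => x v `^ k) ->
  exists2 a, abs_Nbar p k a & backward_diff (weighted_mean p a) =
    fun v => sg v * (v%:R `^ (- q^-1) * x v).
Proof.
move=> p0 k1 q0 kq x0 sg1 xs.
have k0 : 0 < k by lra.
have [|a aE] := @mean_diff_surj _ p
    (fun v => sg v * (v%:R `^ (- q^-1) * x v)) p0.
  by rewrite powR0 ?mul0r ?mulr0// oppr_eq0 invr_eq0 gt_eqF.
exists a => //; rewrite abs_NbarE aE.
apply: (bounded_sums_le (C := 1)) xs => // v v1; rewrite mul1r.
have v0 : (0 : R) < v%:R by rewrite ltr0n.
apply: (@le_trans _ _ (v%:R `^ (k - 1) * (v%:R `^ (- q^-1) * x v) `^ k)).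
  rewrite ler_wpM2l ?powR_ge0//.
  apply: ge0_ler_powR; rewrite ?nnegrE ?(ltW k0) ?mulr_ge0 ?powR_ge0//.
  rewrite normrM [X in _ * X]ger0_norm ?mulr_ge0 ?powR_ge0//.
  by rewrite ler_piMl// mulr_ge0 ?powR_ge0.
rewrite powRM ?powR_ge0// mulrA -powRrM -powRD ?(gt_eqF v0) ?implybT//.
rewrite (_ : _ + _ = 0) ?powRr0 ?mul1r//.
rewrite (_ : q^-1 = 1 - k^-1); last by lra.
by field; rewrite gt_eqF.
Qed.

(** With alternating signs there is no cancellation between the two terms of
    the right-hand side of [cesaro_recurrence] that come from [X], so that
    [c n |X n|] is at most [(n - 1) |D (n - 1)| + 2 n |D n|], which is
    [O(n ^ (1 / s))] when the series is summable |C, 1|_s. This bounds a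
    family of one-point functionals at [X], and [dual_bounded] makes it
    uniform. *)
Lemma diag_necessary (R : realType) (p : nat -> R) (k s q : R) :
  (forall i, 0 < p i) -> 1 < k -> 1 < s -> 0 < q -> k^-1 + q^-1 = 1 ->
  method_implies (abs_Nbar p k) (abs_C1 s) ->
  exists C, forall n, (1 <= n)%N ->
    n%:R `^ (1 / k - 1 / s - 1) * weight_ratio p n <= C.
Proof.
move=> p0 k1 s1 q0 kq imp.
have s0 : 0 < s by lra.
pose c := weight_ratio p.
have c1 n : 1 <= c n by exact: weight_ratio_ge1.
have c0 n : 0 <= c n by apply: le_trans (c1 n).
pose w (m v : nat) : R :=
  if v == m then v%:R `^ (1 / k - 1 / s - 1) * c v else 0.
have w0 m v : 0 <= w m v.
  by rewrite /w; case: ifP => // _; rewrite mulr_ge0 ?powR_ge0.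
have sumw (f : R -> nat -> R) m : (1 <= m)%N -> (forall v, f 0 v = 0) ->
    \sum_(1 <= v < m.+1) f (w m v) v = f (w m m) m.
  case: m => // m _ f0; rewrite big_nat_recr//= big_nat big1 ?add0r// => v.
  by move=> /andP[_ vm]; rewrite /w ltn_eqF.
have [|C CP] := dual_bounded k1 q0 kq w0.
  move=> x x0 xs.
  have sg1 v : `|(-1) ^+ v : R| <= 1 by rewrite normrX normrN1 expr1n.
  have [a aN aX] := test_series p0 k1 q0 kq x0 sg1 xs.
  have := imp _ aN; rewrite (abs_C1E _ s1).
  set D := backward_diff (weighted_mean (fun=> 1) a) => Ds.
  have D0 n : 0 <= (n%:R * `|D n|) `^ s / n%:R by rewrite divr_ge0 ?powR_ge0.
  have [M M0 DM] := bounded_sums_term D0 Ds.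
  have Dn n N : (n <= N)%N -> (1 <= N)%N ->
      n%:R * `|D n| <= M `^ s^-1 * N%:R `^ s^-1.
    move=> nN N1; case: n nN => [|n] nN.
      by rewrite mul0r mulr_ge0 ?powR_ge0.
    rewrite -powRM//; apply: le_powR_inv => //.
    have := DM n.+1 isT; rewrite ler_pdivrMr ?ltr0n// => /le_trans; apply.
    by rewrite ler_wpM2l// ler_nat.
  (* In the recurrence the terms at [m] and [m.+1] now have equal signs. *)
  exists (3 * M `^ s^-1) => -[//|m] _.
  rewrite (sumw (fun t v => t * x v))//; last first.
    by move=> v; rewrite mul0r.
  rewrite /w eqxx.
  pose z v := v%:R `^ (- q^-1) * x v.
  have z0 v : 0 <= z v by rewrite mulr_ge0 ?powR_ge0.
  have m0 : (0 : R) < m.+1%:R by rewrite ltr0n.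
  have cz : c m.+1 * z m.+1 <= 3 * M `^ s^-1 * m.+1%:R `^ s^-1.
    have := cesaro_recurrence a m p0; rewrite aX /= -/D -/c -!/(z _) => rec.
    have e : (-1) ^+ m * (m%:R * D m - (m%:R + 2) * D m.+1) =
        (c m - 1) * z m + c m.+1 * z m.+1.
      rewrite rec exprS.
      have := sqrr_sign R m; rewrite expr2.
      move: ((-1) ^+ m) => t tt.
      rewrite (_ : _ * _ = (t * t) * ((c m - 1) * z m + c m.+1 * z m.+1)).
        by rewrite tt mul1r.
      ring.
    have : c m.+1 * z m.+1 <= `|(-1) ^+ m * (m%:R * D m - (m%:R + 2) * D m.+1)|.
      rewrite e ger0_norm; last by rewrite addr_ge0// mulr_ge0// subr_ge0.
      by rewrite lerDr mulr_ge0// subr_ge0.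
    move/le_trans; apply; rewrite normrM normrX normrN1 expr1n mul1r.
    apply: le_trans (ler_normB _ _) _; rewrite !normrM.
    rewrite (ger0_norm (ler0n _ _)) (@ger0_norm _ (m%:R + 2)) ?addr_ge0//.
    have h1 := Dn m m.+1 (leqnSn m) isT.
    have h2 := Dn m.+1 m.+1 (leqnn _) isT.
    have h3 : (m%:R + 2) * `|D m.+1| <= 2 * (m.+1%:R * `|D m.+1|).
      rewrite mulrA ler_wpM2r// -natr1.
      by have := ler0n R m; clear; lra.
    move: h1 h2 h3; rewrite -!mulrA; move: (_ * m.+1%:R `^ _) => b.
    by clear; lra.
  rewrite (_ : 1 / k - 1 / s - 1 = - s^-1 + - q^-1); last by lra.
  rewrite powRD ?(gt_eqF m0) ?implybT//.
  rewrite (_ : _ * c m.+1 * x m.+1 = m.+1%:R `^ (- s^-1) * (c m.+1 * z m.+1)).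
    by rewrite powRN mulrC ler_pdivrMr ?powR_gt0.
  by rewrite /z; ring.
exists (C `^ q^-1) => n n1.
have := CP n n1; rewrite (sumw (fun t _ => t `^ q))//; last first.
  by move=> _; rewrite powR0// gt_eqF.
rewrite /w eqxx => h.
have u0 : 0 <= n%:R `^ (1 / k - 1 / s - 1) * c n by rewrite mulr_ge0 ?powR_ge0.
exact: le_powR_inv.
Qed.

(** With the signs of the coefficients the sums of the factorable part are
    nondecreasing, hence [O(m)] by [sums_linear_growth]. Divided by [m] they
    are positive functionals, and the bound on their norms given by
    [dual_bounded] is the claim. *)
Lemma defect_necessary (R : realType) (p : nat -> R) (k s q C : R) :
  (forall i, 0 < p i) -> 1 < k -> k <= s -> 0 < q -> k^-1 + q^-1 = 1 ->
  (forall n, (1 <= n)%N ->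
    n%:R `^ (1 / k - 1 / s - 1) * weight_ratio p n <= C) ->
  method_implies (abs_Nbar p k) (abs_C1 s) ->
  exists B, forall m, (1 <= m)%N ->
    \sum_(1 <= v < m.+1) `|v%:R + 1 - weight_ratio p v| `^ q / v%:R <=
    B * m%:R `^ q.
Proof.
move=> p0 k1 ks q0 kq cC imp.
have s1 : 1 < s by lra.
pose d v := v%:R + 1 - weight_ratio p v.
pose w (m v : nat) : R := `|d v| * v%:R `^ (- q^-1) / m%:R.
have w0 m v : 0 <= w m v by rewrite !mulr_ge0 ?powR_ge0 ?invr_ge0.
have [|B BP] := dual_bounded k1 q0 kq w0.
  move=> x x0 xs.
  have sg1 v : `|Num.sg (d v)| <= 1 by rewrite normr_sg lern1 leq_b1.
  have [a aN aX] := test_series p0 k1 q0 kq x0 sg1 xs.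
  have c0 n : 0 <= weight_ratio p n by apply: le_trans (weight_ratio_ge1 n p0).
  have cX := ratio_bounded_sums k1 ks c0 cC ((abs_NbarE p a k).1 aN).
  have := (abs_C1_defect_sum p0 s1 cX).1 (imp _ aN); rewrite aX.
  pose t v := `|d v| * (v%:R `^ (- q^-1) * x v).
  have t0 v : 0 <= t v by rewrite !mulr_ge0 ?powR_ge0.
  have SE n :
      `|defect_sum p (fun v => Num.sg (d v) * (v%:R `^ (- q^-1) * x v)) n| =
      \sum_(1 <= v < n) t v.
    rewrite /defect_sum (eq_bigr t) => [|v _].
      by rewrite ger0_norm ?sumr_ge0.
    by rewrite -/(d v) /t mulrA [d v * _]mulrC -normrEsg.
  under eq_fun do rewrite SE.
  move=> /(sums_linear_growth (lt_trans ltr01 s1) t0)[B BP]; exists B => m m1.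
  have m0 : (0 : R) < m%:R by rewrite ltr0n.
  rewrite (eq_bigr (fun v => t v / m%:R)) => [|v _]; last first.
    by rewrite /w /t; ring.
  by rewrite -big_distrl/= ler_pdivrMr// BP.
exists B => m m1; have m0 : (0 : R) < m%:R by rewrite ltr0n.
rewrite -ler_pdivrMr ?powR_gt0//; apply: le_trans (BP m m1).
rewrite big_distrl/= le_eqVlt; apply/orP; left; apply/eqP.
apply: eq_big_nat => v /andP[v1 _].
rewrite /w !powRM ?mulr_ge0 ?powR_ge0 ?invr_ge0// -powRrM mulNr mulVf ?gt_eqF//.
rewrite powR_inv1//; congr (_ * _).
by rewrite -[in RHS](powR_inv1 (ltW m0)) powRAC powR_inv1 ?powR_ge0.
Qed.

(** * The two conditions *)

Lemma defect_bound_root (R : realType) (q : R) (F : nat -> R) : 0 < q ->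
  (forall m, 0 <= F m) ->
  bigO_ge1 (fun m => F m `^ (1 / q)) (fun m => m%:R) <->
  exists B, forall m, (1 <= m)%N -> F m <= B * m%:R `^ q.
Proof.
move=> q0 F0; rewrite div1r; split=> -[B BP].
- exists (B `^ q) => m m1.
  have := BP m m1; rewrite ger0_norm ?powR_ge0// normr_nat => h.
  have B0 : 0 <= B.
    have := BP 1%N isT; rewrite normr_nat mulr1; exact: le_trans.
  rewrite -powRM//.
  have -> : F m = (F m `^ q^-1) `^ q by rewrite -powRrM mulVf ?gt_eqF// powRr1.
  by apply: ge0_ler_powR; rewrite ?nnegrE ?(ltW q0) ?powR_ge0 ?mulr_ge0.
- exists (B `^ q^-1) => m m1; rewrite ger0_norm ?powR_ge0// normr_nat.
  have B0 : 0 <= B.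
    by have := BP 1%N isT; rewrite powR1 mulr1; exact: le_trans.
  have -> : m%:R = (m%:R `^ q) `^ q^-1 :> R.
    by rewrite -powRrM divff ?gt_eqF// powRr1.
  rewrite -powRM ?powR_ge0//.
  by apply: ge0_ler_powR;
    rewrite ?nnegrE ?invr_ge0 ?(ltW q0) ?powR_ge0 ?mulr_ge0 ?powR_ge0 ?BP.
Qed.

Theorem corollary2 (R : realType) (p : nat -> R) (k s kstar : R)
    (p_gt0 : forall n : nat, 0 < p n)
    (k_gt1 : 1 < k) (le_ks : k <= s)
    (kstar_conj : 1 / k + 1 / kstar = 1) :
  method_implies (abs_Nbar p k) (abs_C1 s) <->
  bigO_ge1
    (fun n => n%:R `^ (1 / k - 1 / s - 1) * partial_sum p n / p n)
    (fun=> 1)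
  /\
  bigO_ge1
    (fun m => (\sum_(1 <= v < m.+1)
                 `|v%:R + 1 - partial_sum p v / p v| `^ kstar * (1 / v%:R))
              `^ (1 / kstar))
    (fun m => m%:R).
Proof.
have kq : k^-1 + kstar^-1 = 1 by move: kstar_conj; rewrite !div1r.
have k0 : 0 < k by lra.
have k1 : k^-1 < 1 by rewrite invf_lt1.
have k_inv : 0 < k^-1 by rewrite invr_gt0.
have q0 : 0 < kstar by rewrite -invr_gt0; lra.
have q1 : 1 < kstar by rewrite -(invf_lt1 q0); lra.
have s1 : 1 < s by lra.
have c0 n : 0 <= weight_ratio p n by apply: le_trans (weight_ratio_ge1 n p_gt0).
pose F m := \sum_(1 <= v < m.+1) `|v%:R + 1 - weight_ratio p v| `^ kstar / v%:R.
have F0 m : 0 <= F m.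
  by apply: sumr_ge0 => v _; rewrite divr_ge0 ?powR_ge0.
have -> : (fun m => (\sum_(1 <= v < m.+1)
        `|v%:R + 1 - partial_sum p v / p v| `^ kstar * (1 / v%:R))
      `^ (1 / kstar)) =
    fun m => F m `^ (1 / kstar).
  apply/funext => m; congr (_ `^ _); apply: eq_bigr => v _.
  by rewrite (div1r v%:R).
have [rootF Froot] := defect_bound_root q0 F0.
have diagE : bigO_ge1
    (fun n => n%:R `^ (1 / k - 1 / s - 1) * partial_sum p n / p n) (fun=> 1) <->
    exists C, forall n, (1 <= n)%N ->
      n%:R `^ (1 / k - 1 / s - 1) * weight_ratio p n <= C.
  have nE n : `|n%:R `^ (1 / k - 1 / s - 1) * partial_sum p n / p n| =
      n%:R `^ (1 / k - 1 / s - 1) * weight_ratio p n.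
    by rewrite -mulrA -/(weight_ratio p n) ger0_norm// mulr_ge0 ?powR_ge0.
  by split=> -[C CP]; exists C => n /CP; rewrite nE normr1 mulr1.
split=> [imp|[/diagE[C CP] /rootF[B BP]] a aN].
- have [C CP] := diag_necessary p_gt0 k_gt1 s1 q0 kq imp.
  have [B BP] := defect_necessary p_gt0 k_gt1 le_ks q0 kq CP imp.
  by split; [apply/diagE; exists C|apply: Froot; exists B].
- have aX := (abs_NbarE p a k).1 aN.
  apply/(abs_C1_defect_sum p_gt0 s1 (ratio_bounded_sums k_gt1 le_ks c0 CP aX)).
  exact: (factorable_bounded_sums k_gt1 le_ks q1 kq BP aX).
Qed.
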